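(* Let $n \geq 2$ and let the symmetric group $S_n$ act on the standard representation $V = \mathbf{C}^{n-1}$. Then $$\mathrm{diam}_+^{S_n}(V, U) = \Bigl\lceil \frac{n-1}{\dim U} \Bigr\rceil \quad \text{for every nonzero subspace } U \leq V,$$ and hence $\mathsf{C}(V) = 1$.
   Context: The standard representation of $S_n$ is the $(n-1)$-dimensional space of vectors in $\mathbf{C}^n$ with coordinate sum zero, with $S_n$ permuting coordinates. For a group $H$ acting linearly on a finite-dimensional complex vector space $V$ and a nonzero subspace $U \leq V$, the group-additive diameter is $$\mathrm{diam}_+^{H}(V,U) = \min\{ m \mid g_1\cdot U + \dots + g_m\cdot U = V \text{ for some } g_1,\dots,g_m \in H\}.$$ If $H$ acts irreducibly on $V$, put $\mathsf{R}(V,U) = \mathrm{diam}_+^{H}(V,U) / \lceil \dim V/\dim U\rceil$, and the covering complexity of $V$ (with respect to $H$) is $\mathsf{C}(V) = \max_{0 \neq U \leq V} \mathsf{R}(V,U)$. *)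

(* Defs.v *)
From mathcomp Require Import all_boot all_order all_fingroup all_algebra.
From mathcomp Require Import mxrepresentation complex.
From mathcomp Require Import boolp classical_sets reals.

Set Implicit Arguments.
Unset Strict Implicit.
Unset Printing Implicit Defensive.

Import Order.TTheory GRing.Theory Num.Theory.
Local Open Scope ring_scope.

(* As in mxrepresentation, a subspace is the row space of a matrix, and g acts *)
(* on row vectors by v |-> v *m rG g. This is a right action; the left action  *)
(* is g . v = v *m rG g^-1, and exchanging the two does not affect the sets of *)
(* translates of U below, since the g_i range over the whole group.            *)
(* V is the space acted upon, given as a submodule of the row space 'rV[F]_n.  *)
Section AdditiveDiameter.

Variables (F : fieldType) (gT : finGroupType) (G : {group gT}) (n : nat).
Variable rG : mx_representation F G n.

Definition translates_cover (V U : 'M[F]_n) (m : nat) : bool :=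
  [exists g : {ffun 'I_m -> gT},
     [forall i, g i \in G] && (\sum_(i < m) U *m rG (g i) == V)%MS].

(* The value 0 is a default for the case where no m is suitable; when V != 0,  *)
(* the value is 0 only in that case.                                           *)
Definition additive_diam (V U : 'M[F]_n) : nat :=
  if pselect (exists m, translates_cover V U m) is left cover_ex
  then ex_minn cover_ex else 0%N.

Definition covering_ratio (V U : 'M[F]_n) : rat :=
  (additive_diam V U)%:R
    / (Num.ceil ((\rank V)%:R / (\rank U)%:R : rat))%:~R.

Definition covering_ratios (V : 'M[F]_n) : set rat :=
  [set r | exists U : 'M[F]_n,
     [/\ U != 0, (U <= V)%MS & r = covering_ratio V U]]%classic.

(* The maximum of the ratios, or the default 0 if the maximum does not exist.  *)
(* Meaningful when V is irreducible, i.e. mxsimple rG V.                       *)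
Definition covering_complexity (V : 'M[F]_n) : rat :=
  xget 0 (covering_ratios V `&` ubound (covering_ratios V))%classic.

End AdditiveDiameter.

Section Standard.

Variables (F : fieldType) (n : nat).

Lemma perm_mx_repr : mx_repr [set: 'S_n]%G (@perm_mx F n).
Proof. by split=> [|s t _ _]; rewrite ?perm_mx1 ?perm_mxM. Qed.

Definition perm_repr : mx_representation F [set: 'S_n]%G n :=
  MxRepresentation perm_mx_repr.

(* v *m const_mx 1 is the sum of the coordinates of v. *)
Definition standard_space : 'M[F]_n := kermx (const_mx 1 : 'cV[F]_n).

End Standard.

(* Main.v *)
Require Import Defs.
From mathcomp Require Import all_boot all_order all_fingroup all_algebra.
From mathcomp Require Import mxrepresentation complex.
From mathcomp Require Import zify.
From mathcomp Require Import boolp classical_sets reals.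

Set Implicit Arguments.
Unset Strict Implicit.
Unset Printing Implicit Defensive.

Import Order.TTheory GRing.Theory Num.Theory.
Local Open Scope ring_scope.

(** The heart of the matter is a statement about two subspaces U and W of the
standard space V, over any field in which n is invertible: some permutation s
puts them in general position, that is
  dim (U + s.W) = min (dim V, dim U + dim W)
([exists_perm_general_position]). To see this, choose s so that U + s.W has
the largest possible dimension, and rename s.W to W. Let i and j be two
indices for which
  - some x in the intersection of U and W satisfies x_i <> x_j, and
  - e_i - e_j does not belong to U + W.
Since x - (i j).x is a nonzero multiple of e_i - e_j, this vector belongs to
U + (i j).W; hence so does w = (i j).w + (w_i - w_j)(e_i - e_j) for each w
in W. So U + (i j).W contains U + W strictly ([rank_addsmx_tperm_gt]),
against the choice of s. Hence each pair i, j is related by one of the two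
relations
  - x_i = x_j for all x in the intersection of U and W,
  - e_i - e_j belongs to U + W.
Both are equivalence relations, and a set on which two equivalence relations
leave no pair unrelated is a single class for one of them
([total_union_of_equivalences]). In the first case the vectors of the
intersection are constant with coordinate sum 0, hence zero, and the sum is
direct; in the second case U + W contains all the e_i - e_j, hence equals V.

Adding translates of U one at a time in general position gives, for each m,
a sum of m translates of dimension min (n - 1, m dim U). A sum of m translates
never has dimension above m dim U, so m translates can cover V exactly when
n - 1 <= m dim U ([translates_cover_standard]). This yields the diameter, and
the irreducibility of V too: a nonzero submodule contains all its translates,
and some of these add up to V. *)

(** If a and b are not P-related, every c is Q-related to a: either directly,
or through b, since c cannot be P-related to both a and b. *)
Lemma total_union_of_equivalences (T : finType) (P Q : rel T) :
    symmetric P -> transitive P -> symmetric Q -> transitive Q ->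
    (forall i j, P i j || Q i j) ->
  (forall i j, P i j) \/ (forall i j, Q i j).
Proof.
move=> symP trP symQ trQ PQ.
have [allP|] := boolP [forall i, forall j, P i j].
  by left=> i j; move/forallP/(_ i)/forallP/(_ j): allP.
case/forallPn=> a /forallPn[b notPab]; right.
have Qab : Q a b by have := PQ a b; rewrite (negPf notPab).
have Qa c : Q a c.
  have /orP[Pac|//] := PQ a c; have /orP[Pbc|Qbc] := PQ b c.
    by rewrite symP in Pbc; rewrite (trP _ _ _ Pac Pbc) in notPab.
  exact: trQ Qab Qbc.
by move=> c d; apply: trQ (Qa d); rewrite symQ.
Qed.

(** Transposing two coordinates of v subtracts (v_i - v_j)(e_i - e_j); here
this is done for all the rows of a matrix at once. *)
Lemma mulmx_tperm {R : pzRingType} {p n : nat} (A : 'M[R]_(p, n)) (i j : 'I_n) :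
  A *m perm_mx (tperm i j) = A - (col i A - col j A) *m ('e_i - 'e_j).
Proof.
rewrite -[perm_mx _]/(tperm_mx i j) -xcolE; apply/matrixP=> k l.
rewrite !mxE big_ord1 !mxE !eqxx /=.
case: tpermP => [->|->|/eqP/negPf-> /eqP/negPf->].
- rewrite eqxx; have [->|_] := eqVneq i j; first by rewrite !subrr mulr0 subr0.
  by rewrite subr0 mulr1 opprB addrC subrK.
- rewrite eqxx; have [->|_] := eqVneq j i; first by rewrite !subrr mulr0 subr0.
  by rewrite sub0r mulrN1 opprK addrC subrK.
- by rewrite subrr mulr0 subr0.
Qed.

(** The exchange step: a transposition of W that enlarges U + W. The first
hypothesis says that some vector x common to U and W has x_i <> x_j; the gain
is e_i - e_j, a multiple of the difference of x and its transposed vector. *)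
Lemma rank_addsmx_tperm_gt {F : fieldType} {p q n : nat}
    (U : 'M[F]_(p, n)) (W : 'M[F]_(q, n)) (i j : 'I_n) :
    col i (U :&: W)%MS != col j (U :&: W)%MS ->
    ~~ (('e_i - 'e_j : 'rV[F]_n) <= U + W)%MS ->
  (\rank (U + W)%MS < \rank (U + W *m perm_mx (tperm i j))%MS)%N.
Proof.
set X := (U :&: W)%MS; set e := 'e_i - 'e_j; set Wt := W *m _.
rewrite -subr_eq0 => /matrix0Pn[k [z Xij_neq0]] e_notin.
have eUWt : (e <= U + Wt)%MS.
  (* The row space of X lies in U, and its image under (i j) in that of W. *)
  have cE : ((col i X - col j X) *m e <= U + Wt)%MS.
    have -> : (col i X - col j X) *m e = X - X *m perm_mx (tperm i j).
      by rewrite mulmx_tperm subKr.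
    by rewrite addmx_sub_adds ?capmxSl // eqmx_opp submxMr ?capmxSr.
  have rowE : row k ((col i X - col j X) *m e) = (col i X - col j X) k z *: e.
    by rewrite row_mul; apply/rowP=> l; rewrite !mxE big_ord1 !mxE ord1.
  by rewrite -(eqmx_scale _ Xij_neq0) -rowE (submx_trans (row_sub _ _)).
apply: rank_ltmx; rewrite ltmxE; apply/andP; split; last first.
  by apply: contra e_notin => /(submx_trans eUWt).
rewrite addsmx_sub addsmxSl /=.
have -> : W = Wt + (col i W - col j W) *m e.
  by rewrite /Wt mulmx_tperm subrK.
by rewrite addmx_sub ?addsmxSr // (submx_trans (submxMl _ _)).
Qed.

Lemma standard_space_sumE {F : fieldType} {p n : nat} (A : 'M[F]_(p, n)) k :
  (A <= standard_space F n)%MS -> \sum_j A k j = 0.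
Proof.
move=> /sub_kermxP/matrixP/(_ k ord0); rewrite !mxE => sum0.
by rewrite -[RHS]sum0; apply: eq_bigr => j _; rewrite mxE mulr1.
Qed.

Lemma rank_standard_space {F : fieldType} {n : nat} :
  (0 < n)%N -> \rank (standard_space F n) = n.-1.
Proof.
move=> n_gt0; rewrite mxrank_ker -subn1; congr (_ - _)%N.
apply/eqP; rewrite eqn_leq rank_leq_col lt0n mxrank_eq0.
by apply/matrix0Pn; exists (Ordinal n_gt0), ord0; rewrite mxE oner_eq0.
Qed.

Lemma standard_space_mul_perm {F : fieldType} {p n : nat} (A : 'M[F]_(p, n))
    (s : 'S_n) :
  (A <= standard_space F n)%MS -> (A *m perm_mx s <= standard_space F n)%MS.
Proof.
move=> /sub_kermxP A0; apply/sub_kermxP; rewrite -mulmxA -row_permE.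
rewrite (_ : row_perm s _ = const_mx 1) //.
by apply/matrixP=> i j; rewrite !mxE.
Qed.

(** This is where n must be invertible: when n = 0 in F, the constant vectors
lie in the standard space. *)
Lemma constant_in_standard_space_eq0 {F : fieldType} {p n : nat}
    (A : 'M[F]_(p, n)) :
    n%:R != 0 :> F -> (A <= standard_space F n)%MS ->
    (forall i j, col i A = col j A) ->
  A = 0.
Proof.
move=> n_neq0 AV colA; apply/matrixP=> k i; rewrite mxE.
have colkA j : A k j = A k i by have /colP/(_ k) := colA j i; rewrite !mxE.
have /eqP := standard_space_sumE k AV.
under eq_bigr => j _ do rewrite colkA.
by rewrite sumr_const card_ord -mulr_natr mulf_eq0 (negPf n_neq0) orbF => /eqP.
Qed.

(** The vectors e_i - e_j span the standard space: if the coordinates of v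
add up to 0, then v = sum_j v_j e_j = sum_j v_j (e_j - e_i) for any fixed i. *)
Lemma standard_space_sub {F : fieldType} {p n : nat} (S : 'M[F]_(p, n)) :
    (forall i j, (('e_i - 'e_j : 'rV[F]_n) <= S)%MS) ->
  (standard_space F n <= S)%MS.
Proof.
move=> eS; apply/row_subP=> i; set v := row i _.
have -> : v = \sum_j v 0 j *: ('e_j - 'e_i).
  under eq_bigr => j _ do rewrite scalerBr.
  rewrite sumrB -row_sum_delta -scaler_suml (standard_space_sumE 0) ?row_sub //.
  by rewrite scale0r subr0.
by apply: summx_sub => j _; rewrite scalemx_sub.
Qed.

(** A translate of W of maximal dimension of the sum with U works, because no
exchange step can improve it. *)
Lemma exists_perm_general_position {F : fieldType} {p q n : nat}
    (U : 'M[F]_(p, n)) (W : 'M[F]_(q, n)) :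
    n%:R != 0 :> F ->
    (U <= standard_space F n)%MS -> (W <= standard_space F n)%MS ->
  exists s : 'S_n,
    \rank (U + W *m perm_mx s)%MS = minn n.-1 (\rank U + \rank W).
Proof.
move=> n_neq0 UV WV.
have n_gt0 : (0 < n)%N by case: (n) n_neq0 => //; rewrite eqxx.
pose r (s : 'S_n) := \rank (U + W *m perm_mx s)%MS.
have [s _ s_max] := @arg_maxnP _ 1%g xpredT r isT; exists s; move: s_max.
rewrite {}/r; set Ws := W *m perm_mx s => s_max.
have WsV : (Ws <= standard_space F n)%MS by apply: standard_space_mul_perm.
have UWsV : (U + Ws <= standard_space F n)%MS by rewrite addsmx_sub UV.
have rankWs : \rank Ws = \rank W.
  by rewrite mxrankMfree // row_free_unit unitmx_perm.
have le_dimV : (\rank (U + Ws)%MS <= n.-1)%N.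
  by rewrite -(@rank_standard_space F) ?mxrankS.
pose X := (U :&: Ws)%MS.
pose P : rel 'I_n := fun i j => col i X == col j X.
pose Q : rel 'I_n := fun i j => (('e_i - 'e_j : 'rV[F]_n) <= U + Ws)%MS.
have PQ i j : P i j || Q i j.
  (* Otherwise following s by (i j) would beat the maximal rank. *)
  apply: contraT; rewrite negb_or => /andP[Pij Qij].
  have := rank_addsmx_tperm_gt Pij Qij.
  rewrite /Ws -mulmxA -perm_mxM ltnNge => /negP[].
  exact: (s_max (s * tperm i j)%g isT).
have symP : symmetric P by move=> i j; exact: eq_sym.
have trP : transitive P by move=> j i k /eqP Pij /eqP Pjk; rewrite /P Pij Pjk.
have symQ : symmetric Q by move=> i j; rewrite /Q -opprB eqmx_opp.
have trQ : transitive Q.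
  by move=> j i k Qij Qjk; rewrite /Q -(subrKA 'e_j) addmx_sub.
rewrite -rankWs.
have [allP|allQ] := total_union_of_equivalences symP trP symQ trQ PQ.
  have X0 : X = 0.
    apply: constant_in_standard_space_eq0 => //.
      exact: submx_trans (capmxSl _ _) UV.
    by move=> i j; apply/eqP/allP.
  have := mxrank_sum_cap U Ws; rewrite -/X X0 mxrank0 addn0 => rankUWs.
  by rewrite -rankUWs (minn_idPr le_dimV).
have rankUWs : \rank (U + Ws)%MS = n.-1.
  apply/eqP; rewrite eqn_leq le_dimV -(@rank_standard_space F) //.
  exact/mxrankS/standard_space_sub.
by have := mxrank_adds_leqif U Ws => -[]; rewrite rankUWs => /minn_idPl.
Qed.

(** Greedy choice: each new translate is put in general position with respect
to the sum of the previous ones. *)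
Lemma exists_translates_rank {F : fieldType} {n : nat} (U : 'M[F]_n) (m : nat) :
    n%:R != 0 :> F -> (U <= standard_space F n)%MS ->
  exists g : nat -> 'S_n,
    \rank (\sum_(i < m) U *m perm_mx (g i))%MS = minn n.-1 (m * \rank U).
Proof.
move=> n_neq0 UV; elim: m => [|m [g rank_g]].
  by exists (fun=> 1%g); rewrite big_ord0 mxrank0 minn0.
have gV : (\sum_(i < m) U *m perm_mx (g i) <= standard_space F n)%MS.
  by apply/sumsmx_subP=> i _; apply: standard_space_mul_perm.
have [s rank_s] := exists_perm_general_position n_neq0 gV UV.
exists (fun k => if k == m then s else g k).
rewrite big_ord_recr /= eqxx.
under eq_bigr => i _ do rewrite ltn_eqF //.
rewrite rank_s rank_g mulSn addnC.
by lia.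
Qed.

Lemma translates_cover_standard {F : fieldType} {n : nat} (U : 'M[F]_n)
    (m : nat) :
    n%:R != 0 :> F -> (U <= standard_space F n)%MS ->
  translates_cover (perm_repr F n) (standard_space F n) U m
    = (n.-1 <= m * \rank U)%N.
Proof.
move=> n_neq0 UV.
have n_gt0 : (0 < n)%N by case: (n) n_neq0 => //; rewrite eqxx.
apply/existsP/idP=> [[g /andP[_ /eqmx_rank]]|le_n].
  rewrite rank_standard_space // => <-.
  rewrite (leq_trans (mxrank_sum_leqif _)) //=.
  rewrite -[m in (_ <= m * _)%N]card_ord -sum_nat_const leq_sum // => i _.
  exact: mxrankM_maxl.
have [g rank_g] := exists_translates_rank m n_neq0 UV.
exists [ffun i : 'I_m => g i]; apply/andP; split.
  by apply/forallP=> i; rewrite inE.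
under eq_bigr => i _ do rewrite ffunE.
rewrite -(geq_leqif (mxrank_leqif_eq _)) ?rank_g ?rank_standard_space //.
  by rewrite leq_min leqnn.
by apply/sumsmx_subP=> i _; apply: standard_space_mul_perm.
Qed.

Lemma ceil_natr_div (a b m : nat) :
    (0 < b)%N -> (0 < a)%N -> (a <= m * b)%N ->
    (forall k, (a <= k * b)%N -> (m <= k)%N) ->
  Num.ceil (a%:R / b%:R : rat) = m%:Z.
Proof.
move=> b_gt0 a_gt0 le_a min_m; apply: ceil_def.
case: m le_a min_m => [|m] le_a min_m; first by rewrite leqNgt a_gt0 in le_a.
have b_gt0' : 0 < b%:R :> rat by rewrite ltr0n.
have -> : m.+1%:Z - 1 = m%:Z by rewrite -addn1 PoszD addrK.
rewrite ltr_pdivlMr // ler_pdivrMr //.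
rewrite -!pmulrn -!natrM ltr_nat ler_nat le_a andbT ltnNge.
by apply/negP=> /min_m; rewrite ltnn.
Qed.

Lemma additive_diam_standard {F : fieldType} {n : nat} (U : 'M[F]_n) :
    (1 < n)%N -> n%:R != 0 :> F -> U != 0 -> (U <= standard_space F n)%MS ->
  (additive_diam (perm_repr F n) (standard_space F n) U)%:Z
    = Num.ceil (n.-1%:R / (\rank U)%:R : rat).
Proof.
move=> n_gt1 n_neq0 U_neq0 UV.
have rankU_gt0 : (0 < \rank U)%N by rewrite lt0n mxrank_eq0.
have coverE m := translates_cover_standard m n_neq0 UV.
rewrite /additive_diam; case: pselect => [cover_ex|no_cover]; last first.
  by case: no_cover; exists n.-1; rewrite coverE leq_pmulr.
case: ex_minnP => m; rewrite coverE => le_n min_m; apply/esym.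
apply: ceil_natr_div => // [|k le_k]; first by rewrite -subn1 subn_gt0.
by apply: min_m; rewrite coverE.
Qed.

(** A nonzero submodule U contains any sum of its translates, and n - 1
translates suffice to cover the standard space. *)
Lemma mxsimple_standard {F : fieldType} {n : nat} :
    (1 < n)%N -> n%:R != 0 :> F ->
  mxsimple (perm_repr F n) (standard_space F n).
Proof.
move=> n_gt1 n_neq0; split=> [||U /mxmoduleP modU UV U_neq0].
- by apply/mxmoduleP=> s _; apply: standard_space_mul_perm.
- rewrite -mxrank_eq0 rank_standard_space ?(ltnW n_gt1) //.
  by rewrite -lt0n -subn1 subn_gt0.
have : translates_cover (perm_repr F n) (standard_space F n) U n.-1.
  by rewrite translates_cover_standard // leq_pmulr // lt0n mxrank_eq0.
case/existsP=> g /andP[_ /eqmxP sumE]; rewrite -sumE.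
by apply/sumsmx_subP=> i _; apply: modU; rewrite inE.
Qed.

Lemma covering_complexity_standard {F : fieldType} {n : nat} :
    (1 < n)%N -> n%:R != 0 :> F ->
  covering_complexity (perm_repr F n) (standard_space F n) = 1.
Proof.
move=> n_gt1 n_neq0; set V := standard_space F n.
have rankV : \rank V = n.-1 by rewrite rank_standard_space ?(ltnW n_gt1).
have rankV_gt0 : (0 < \rank V)%N by rewrite rankV -subn1 subn_gt0.
(* All the ratios equal 1, and U = V provides one. *)
have ratio1 (U : 'M[F]_n) : U != 0 -> (U <= V)%MS ->
    covering_ratio (perm_repr F n) V U = 1.
  move=> U_neq0 UV; rewrite /covering_ratio rankV -additive_diam_standard //.
  rewrite -pmulrn divff // pnatr_eq0 -lt0n -ltz_nat additive_diam_standard //.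
  by rewrite ceil_gt0 divr_gt0 // ltr0n -?rankV // lt0n mxrank_eq0.
have ratio_set1 r : covering_ratios (perm_repr F n) V r <-> r = 1.
  split=> [[U [U_neq0 UV ->]]|->]; first exact: ratio1.
  have V_neq0 : V != 0 by rewrite -mxrank_eq0 -lt0n.
  by exists V; split=> //; rewrite ratio1.
apply: xget_unique => [|r [/ratio_set1]//].
by split=> [|r /ratio_set1->//]; apply/ratio_set1.
Qed.

Theorem corollary4p4 (R : realType) (n : nat) (hn : (2 <= n)%N) :
  let rho := perm_repr R[i] n in
  let V := standard_space R[i] n in
  (forall U : 'M[R[i]]_n, U != 0 -> (U <= V)%MS ->
     (additive_diam rho V U)%:Z = Num.ceil (n.-1%:R / (\rank U)%:R : rat))
  /\ (mxsimple rho V /\ covering_complexity rho V = 1).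
Proof.
have n_neq0 : n%:R != 0 :> R[i] by rewrite pnatr_eq0 -lt0n (ltnW hn).
split=> [U|]; first exact: additive_diam_standard.
by split; [apply: mxsimple_standard | apply: covering_complexity_standard].
Qed.
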